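(* Let $k$ be a positive integer with $k\equiv 24\pmod{49}$, and let $s\in\{19,33,40,47\}$. Then for all integers $n\geq 0$, $$\Delta_{k}(49n+s)\equiv 0\pmod{7}.$$
   Context: For a positive integer $k$, $\Delta_k(n)$ denotes the number of broken $k$-diamond partitions of $n$ (Andrews and Paule). The integers $\Delta_k(n)$, $n\ge 0$, are determined by the generating function $$\sum_{n=0}^{\infty}\Delta_{k}(n)q^{n}=\frac{(q^{2};q^{2})_{\infty}\,(q^{2k+1};q^{2k+1})_{\infty}}{(q;q)_{\infty}^{3}\,(q^{2(2k+1)};q^{2(2k+1)})_{\infty}},$$ where $|q|<1$ (or as formal power series in $q$) and $(a;q)_{\infty}:=\prod_{n=0}^{\infty}(1-aq^{n})$. This identity may be taken as the definition of $\Delta_k(n)$. *)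

(* Defs.v *)
From HB Require Import structures.
From mathcomp Require Import all_boot all_order all_algebra.

Set Implicit Arguments.
Unset Strict Implicit.
Unset Printing Implicit Defensive.

Import Order.TTheory GRing.Theory Num.Theory.
Local Open Scope ring_scope.

(* A formal power series in q over the integers is its coefficient sequence;
   the polynomial variable 'X plays the role of q. *)
Definition fps := nat -> int.

Definition fps_one : fps := fun n => (n == 0%N)%:R.

Definition fps_mul (f g : fps) : fps :=
  fun n => \sum_(i < n.+1) f i * g (n - i)%N.

Definition fps_exp (f : fps) (m : nat) : fps := iter m (fps_mul f) fps_one.

(* The quotient f / g when g 0 = 1 (see fps_divK): its coefficients h satisfy
   h_m = f_m - \sum_(i < m) h_i g_(m-i).  fps_div_seq f g n lists the first n
   of them. *)
Fixpoint fps_div_seq (f g : fps) (n : nat) : seq int :=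
  if n is m.+1 then
    let s := fps_div_seq f g m in
    rcons s (f m - \sum_(i < m) s`_i * g (m - i)%N)
  else [::].

Definition fps_div (f g : fps) : fps := fun n => (fps_div_seq f g n.+1)`_n.

(* (a; b)_oo = \prod_(i >= 0) (1 - a b^i), for a and b polynomials in q without
   constant term.  The coefficient of q^n is that of any partial product with
   at least n factors (see qpochE). *)
Definition qpoch (a b : {poly int}) : fps :=
  fun n => (\prod_(i < n.+1) (1 - a * b ^+ i))`_n.

Definition Delta_num (k : nat) : fps :=
  fps_mul (qpoch 'X^2 'X^2) (qpoch 'X^(2 * k + 1) 'X^(2 * k + 1)).

Definition Delta_den (k : nat) : fps :=
  fps_mul (fps_exp (qpoch 'X 'X) 3)
          (qpoch 'X^(2 * (2 * k + 1)) 'X^(2 * (2 * k + 1))).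

(* The number of broken k-diamond partitions of n, through its generating
   function: see Delta_gf. *)
Definition Delta (k : nat) : fps := fps_div (Delta_num k) (Delta_den k).

Lemma size_fps_div_seq f g n : size (fps_div_seq f g n) = n.
Proof. by elim: n => //= n IHn; rewrite size_rcons IHn. Qed.

Lemma nth_fps_div_seq f g n i :
  (i < n)%N -> (fps_div_seq f g n)`_i = fps_div f g i.
Proof.
elim: n => // n IHn; rewrite ltnS leq_eqVlt => /predU1P[-> //|lt_in].
by rewrite /= nth_rcons size_fps_div_seq lt_in IHn.
Qed.

Lemma fps_divE f g n :
  fps_div f g n = f n - \sum_(i < n) fps_div f g i * g (n - i)%N.
Proof.
rewrite {1}/fps_div /= nth_rcons size_fps_div_seq ltnn eqxx.
by congr (_ - _); apply: eq_bigr => i _; rewrite nth_fps_div_seq.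
Qed.

Lemma fps_divK f g : g 0%N = 1 -> fps_mul (fps_div f g) g =1 f.
Proof.
move=> g0 n; rewrite /fps_mul big_ord_recr /= subnn g0 mulr1.
by rewrite [fps_div f g n]fps_divE addrC subrK.
Qed.

Lemma qpochE (a b : {poly int}) (n N : nat) :
  a`_0 = 0 -> b`_0 = 0 -> (n <= N)%N ->
  qpoch a b n = (\prod_(i < N) (1 - a * b ^+ i))`_n.
Proof.
have divX (p : {poly int}) : p`_0 = 0 -> exists r, p = r * 'X.
  move=> p0; exists (drop_poly 1 p).
  rewrite -[LHS](poly_take_drop 1) expr1; suff ->: take_poly 1 p = 0.
    by rewrite add0r.
  by apply/polyP=> -[|i]; rewrite coef_take_poly coef0 //= p0.
move=> /divX[a' ->] /divX[b' ->].
have step M : (n <= M)%N ->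
  (\prod_(i < M.+1) (1 - a' * 'X * (b' * 'X) ^+ i))`_n =
  (\prod_(i < M) (1 - a' * 'X * (b' * 'X) ^+ i))`_n.
  move=> le_nM; rewrite big_ord_recr /= mulrBr mulr1 coefB.
  by rewrite exprMn mulrACA -exprS !mulrA coefMXn ltnS le_nM subr0.
move=> /subnK <-; rewrite /qpoch step //.
by elim: (N - n)%N => // d IHd; rewrite addSn step ?leq_addl.
Qed.

Lemma qpoch0 (a b : {poly int}) : a`_0 = 0 -> qpoch a b 0 = 1.
Proof.
by move=> a0; rewrite /qpoch big_ord1 expr0 mulr1 coefB coef1 a0 subr0.
Qed.

Lemma fps_mul0 f g : fps_mul f g 0 = f 0%N * g 0%N.
Proof. by rewrite /fps_mul big_ord1. Qed.

Lemma Delta_den0 k : Delta_den k 0 = 1.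
Proof.
rewrite /Delta_den /fps_exp /= !fps_mul0 !qpoch0 ?coefX //.
by rewrite coefXn addn1 mulnS.
Qed.

Lemma Delta_gf k : fps_mul (Delta k) (Delta_den k) =1 Delta_num k.
Proof. exact/fps_divK/Delta_den0. Qed.

(* Main.v *)
Require Import Defs.
From HB Require Import structures.
From mathcomp Require Import all_boot all_order all_algebra.
From mathcomp Require Import boolp finfield.
From mathcomp Require Import ring zify.

(** Write E_d for the product of the 1 - q^(d n), n >= 1, and work in F_7[[q]],
    where f^7 = f(q^7) for every series f.

    The hypothesis on k says that 2k+1 = 49m, so the generating function C of
    Delta_k is E_2 / E_1^3 times a series in q^49.  Multiplying by
    E_1^4 E_2^7 to form seventh powers turns this into
        C (E_1 E_2 E_(14m))(q^7) = F E_(7m)(q^7),   F = E_1^4 E_2^8.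
    Up to a power of q, F is the eta quotient eta(tau)^4 eta(2 tau)^8, a Hecke
    eigenform of weight 6, and modulo 7 the operator T_7 only selects
    coefficients: the coefficient of F at 7n+5 is minus the one at n
    (sect_eulerF).
    Taking this section of the identity leaves
        (section 7n+5 of C) = - E_1^3 . (a series in q^7).
    Modulo 7 the exponents of q in J = E_1^3 are only 0, 1 and 3 modulo 7
    (sect_eulerJ), so the section of C has no exponent congruent to 2, 4, 5 or
    6, and 19, 33, 40, 47 are the 7r + 5 with r in that list.

    The two facts about F and J are proved with the derivation D = q d/dq, in
    terms of which membership of an exponent in a residue class modulo 7 is
    polynomial: one needs (D + 2)^6 F = F + q^5 F(q^7) and (D + 1)^3 J = J.
    The logarithmic derivatives of F and J lie in the ring generated by two
    modular forms of level 2, A of weight 2 and Y of weight 4.  In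
    characteristic 7 this ring is stable under D: the Hasse invariant
    A (A^2 - 2Y) is equal to 1 (hasse_AY), and differentiating this relation
    expresses the quasimodular part of D through A and Y (qderiv_AY).  Both
    claims then become identities between explicit polynomials
    (iter6_qderiv_shift, iter3_qderiv_shift).

    All that is needed about A and Y comes from the theta series
    a = sum of q^(x^2) and b(q) = a(-q), for which A = 2a^4 - b^4 and
    Y = a^4 (a^4 - b^4) / 16.  They satisfy the arithmetic-geometric mean
    relations a(q)^2 + b(q)^2 = 2 a(q^2)^2 and a(q) b(q) = b(q^2)^2.  These
    show that the two sides of each required identity obey the same functional
    equation under q -> q^2, and such an equation has few solutions (dil2_rigid,
    dil2_fix).  This gives the product formula for a^4 - b^4 (quartic_product),
    the derivative of log(a/b) (theta_wronskian) and the Hasse invariant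
    (hasse_theta).  Gauss's identity b E_2 = E_1^2 (gauss_theta4) connects the
    theta series with the products E_d. *)

Set Implicit Arguments.
Unset Strict Implicit.
Unset Printing Implicit Defensive.

Import Order.TTheory GRing.Theory Num.Theory.
Local Open Scope ring_scope.

(** * The ring of formal power series *)

(** A record rather than the bare function type, on which the pointwise ring
    structure would compete with the convolution product. *)
Record pser (R : Type) := Pser { pcoef :> nat -> R }.

HB.instance Definition _ (R : Type) := gen_eqMixin (pser R).
HB.instance Definition _ (R : Type) := gen_choiceMixin (pser R).

Lemma pserP (R : Type) (f g : pser R) : pcoef f =1 pcoef g -> f = g.
Proof. by case: f g => [f] [g] /= fg; congr Pser; apply: funext. Qed.

Section Ring.
Variable R : comNzRingType.
Implicit Types f g h : pser R.

Definition pser_zero : pser R := Pser (fun=> 0).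
Definition pser_opp f := Pser (fun n => - f n).
Definition pser_add f g := Pser (fun n => f n + g n).
Definition pser_one : pser R := Pser (fun n => (n == 0%N)%:R).
Definition pser_mul f g := Pser (fun n => \sum_(i < n.+1) f i * g (n - i)%N).

Fact pser_addA : associative pser_add.
Proof. by move=> f g h; apply: pserP => n; apply: addrA. Qed.
Fact pser_addC : commutative pser_add.
Proof. by move=> f g; apply: pserP => n; apply: addrC. Qed.
Fact pser_add0 : left_id pser_zero pser_add.
Proof. by move=> f; apply: pserP => n; apply: add0r. Qed.
Fact pser_addN : left_inverse pser_zero pser_opp pser_add.
Proof. by move=> f; apply: pserP => n; apply: addNr. Qed.

HB.instance Definition _ := GRing.isZmodule.Build (pser R)
  pser_addA pser_addC pser_add0 pser_addN.

Definition trunc N f : {poly R} := \poly_(i < N) f i.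

Lemma coef_trunc_mul N f g n : (n < N)%N ->
  (trunc N f * trunc N g)`_n = pser_mul f g n.
Proof.
move=> nN; rewrite coefM; apply: eq_bigr => i _; rewrite !coef_poly.
by rewrite !ifT //; apply: leq_ltn_trans nN; rewrite ?leq_subr // -ltnS.
Qed.

Fact pser_mulA : associative pser_mul.
Proof.
move=> f g h; apply: pserP => n.
have trE N (u v : {poly R}) (w : pser R) :
    (forall i, (i < N)%N -> u`_i = v`_i) -> (n < N)%N ->
    (u * trunc N w)`_n = (v * trunc N w)`_n.
  move=> uv nN; rewrite !coefM; apply: eq_bigr => i _; rewrite uv //.
  by apply: leq_ltn_trans nN; rewrite -ltnS.
pose T := trunc n.+1.
have trM a b i : (i < n.+1)%N -> (T (pser_mul a b))`_i = (T a * T b)`_i.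
  by move=> ni; rewrite coef_poly ni coef_trunc_mul.
rewrite -!(@coef_trunc_mul n.+1) // (trE _ _ _ _ (trM f g)) // -mulrA.
by rewrite mulrC (trE _ _ _ _ (trM g h)) // mulrC.
Qed.

Fact pser_mulC : commutative pser_mul.
Proof.
by move=> f g; apply: pserP => n; rewrite -!(@coef_trunc_mul n.+1) // mulrC.
Qed.

Fact pser_mul1 : left_id pser_one pser_mul.
Proof.
move=> f; apply: pserP => n; rewrite /= big_ord_recl /= subn0 mul1r.
by rewrite big1 ?addr0 // => i _; rewrite mul0r.
Qed.

Fact pser_mulDl : left_distributive pser_mul pser_add.
Proof.
move=> f g h; apply: pserP => n /=; rewrite -big_split.
by apply: eq_bigr => i _; rewrite mulrDl.
Qed.

Fact pser_one_neq0 : pser_one != pser_zero.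
Proof.
apply/eqP => /(congr1 (fun h : pser R => h 0%N)) /eqP /=.
by rewrite (oner_eq0 R).
Qed.

HB.instance Definition _ := GRing.Zmodule_isComNzRing.Build (pser R)
  pser_mulA pser_mulC pser_mul1 pser_mulDl pser_one_neq0.

Lemma pcoefD f g n : (f + g) n = f n + g n. Proof. by []. Qed.
Lemma pcoefN f n : (- f) n = - f n. Proof. by []. Qed.
Lemma pcoef0 n : (0 : pser R) n = 0. Proof. by []. Qed.
Lemma pcoef1 n : (1 : pser R) n = (n == 0%N)%:R. Proof. by []. Qed.
Lemma pcoefM f g n : (f * g) n = \sum_(i < n.+1) f i * g (n - i)%N.
Proof. by []. Qed.
Lemma pcoefM0 f g : (f * g) 0%N = f 0%N * g 0%N.
Proof. by rewrite pcoefM big_ord1. Qed.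
Lemma pcoefM1 f g : (f * g) 1%N = f 0%N * g 1%N + f 1%N * g 0%N.
Proof. by rewrite pcoefM big_ord_recl big_ord1. Qed.
Lemma pcoefX0 f m : (f ^+ m) 0%N = f 0%N ^+ m.
Proof. by elim: m => // m IH; rewrite !exprS pcoefM0 IH. Qed.
Lemma pcoefMn f m n : (f *+ m) n = f n *+ m.
Proof. by elim: m => // m IH; rewrite !mulrS pcoefD IH. Qed.
Lemma pcoef_sum I (r : seq I) (P : pred I) (F : I -> pser R) n :
  (\sum_(i <- r | P i) F i) n = \sum_(i <- r | P i) F i n.
Proof. by elim/big_rec2: _ => // i x y _ <-. Qed.

Definition q : pser R := Pser (fun n => (n == 1%N)%:R).

Lemma pcoef_qM f n : (q * f) n = if n is m.+1 then f m else 0.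
Proof.
rewrite pcoefM; case: n => [|n]; first by rewrite big_ord1 mul0r.
rewrite big_ord_recl mul0r add0r big_ord_recl mul1r /= subSS subn0.
by rewrite big1 ?addr0 // => i _; rewrite mul0r.
Qed.

Lemma pcoef_qXM m f n : (q ^+ m * f) n = if (n < m)%N then 0 else f (n - m)%N.
Proof.
elim: m n => [|m IH] n; first by rewrite mul1r subn0.
by rewrite exprS -mulrA pcoef_qM; case: n => // n; rewrite IH ltnS subSS.
Qed.

Lemma pcoef_qX m n : (q ^+ m) n = (n == m)%:R.
Proof.
rewrite -[q ^+ m]mulr1 pcoef_qXM pcoef1 subn_eq0.
by case: ltngtP.
Qed.

Lemma q_mulI : injective ( *%R q).
Proof.
move=> f g fg; apply: pserP => n.
by have := congr1 (fun h : pser R => h n.+1) fg; rewrite !pcoef_qM.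
Qed.

Lemma mulI_coef0 f g h : f 0%N = 1 -> f * g = f * h -> g = h.
Proof.
move=> f0 /eqP; rewrite -subr_eq0 -mulrBr => /eqP; set d := g - h => fd.
suff d0 : d = 0 by apply/eqP; rewrite -subr_eq0 -/d d0.
apply: pserP; elim/ltn_ind => n IH; have := congr1 (fun h : pser R => h n) fd.
rewrite pcoefM big_ord_recl f0 mul1r subn0 big1 ?addr0 // => i _.
rewrite IH ?pcoef0 ?mulr0 //= /bump; case: n i {IH} => [[]|n i] //=.
by rewrite add1n subSS ltnS leq_subr.
Qed.

End Ring.
Arguments q {R}.

(** * The derivation q d/dq, dilation, sign change and sections *)

Section Ops.
Variable R : comNzRingType.
Implicit Types f g h : pser R.

Definition qderiv f : pser R := Pser (fun n => f n *+ n).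

Lemma pcoef_qderiv f n : qderiv f n = f n *+ n.
Proof. by []. Qed.

Fact qderiv_is_zmod_morphism : zmod_morphism qderiv.
Proof. by move=> f g; apply: pserP => n; rewrite /= mulrnBl. Qed.
HB.instance Definition _ :=
  GRing.isZmodMorphism.Build (pser R) (pser R) qderiv qderiv_is_zmod_morphism.

Lemma qderivM f g : qderiv (f * g) = qderiv f * g + f * qderiv g.
Proof.
apply: pserP => n; rewrite pcoefD !pcoefM /= -sumrMnl -big_split /=.
apply: eq_bigr => i _; rewrite mulrnAl mulrnAr -mulrnDr subnKC //.
by rewrite -ltnS.
Qed.

Lemma qderiv1 : qderiv 1 = 0.
Proof. by apply: pserP => -[|n] /=; rewrite ?mulr0n ?mul0rn. Qed.

Lemma qderivX f m : qderiv (f ^+ m) = f ^+ m.-1 * qderiv f *+ m.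
Proof.
elim: m => [|[|m] IH]; first by rewrite qderiv1 mulr0n.
  by rewrite mul1r.
by rewrite exprS qderivM IH /= [_.+2]lock exprS -lock; ring.
Qed.

Lemma qderivD f g : qderiv (f + g) = qderiv f + qderiv g.
Proof. exact: raddfD. Qed.
Lemma qderivB f g : qderiv (f - g) = qderiv f - qderiv g.
Proof. exact: raddfB. Qed.
Lemma qderivMn f m : qderiv (f *+ m) = qderiv f *+ m.
Proof. exact: raddfMn. Qed.
Definition qderivE := (qderivMn, qderivX, qderivB, qderivD, qderivM).

Lemma qderiv_q : qderiv q = q :> pser R.
Proof. by apply: pserP => -[|[|n]]; rewrite /= ?mul0rn. Qed.

(** The series f(q^d).  For d = 0 the conventions on divisibility by 0 make it
    the constant term of f, so that dil d is a ring morphism for every d. *)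
Definition dil d f : pser R :=
  Pser (fun n => if (d %| n)%N then f (n %/ d)%N else 0).

Fact dil_is_zmod_morphism d : zmod_morphism (dil d).
Proof.
by move=> f g; apply: pserP => n /=; case: ifP => // _; rewrite oppr0 addr0.
Qed.

Fact dil_is_monoid_morphism d : monoid_morphism (dil d).
Proof.
split=> [|f g]; apply: pserP => n /=.
  case: d => [|d]; first by rewrite dvd0n divn0; case: n.
  case: dvdnP => [[k ->]|nd]; first by rewrite mulnK // muln_eq0 orbF.
  by case: eqP => // n0; case: nd; exists 0%N.
case: d => [|d].
  rewrite dvd0n divn0 big_ord1; case: n => [|n]; first by rewrite big_ord1.
  by rewrite big1 // => -[[|i] lti] _; rewrite !dvd0n ?mulr0 ?mul0r.
pose T := @trunc R n.+1.
have trE u i : (i < n.+1)%N ->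
    (T (dil d.+1 u))`_i = (T u \Po 'X^(d.+1))`_i.
  move=> ni; rewrite coef_poly ni coef_comp_poly_Xn // coef_poly /=.
  by rewrite (leq_ltn_trans (leq_div _ _) ni).
transitivity ((T (dil d.+1 f) * T (dil d.+1 g))`_n); last first.
  by rewrite coef_trunc_mul.
transitivity (((T f * T g) \Po 'X^(d.+1))`_n).
  rewrite coef_comp_poly_Xn //; case: ifP => // _.
  by rewrite coef_trunc_mul // ltnS leq_div.
rewrite rmorphM !coefM; apply: eq_bigr => i _.
by rewrite !trE // ltnS leq_subr.
Qed.

HB.instance Definition _ d :=
  GRing.isZmodMorphism.Build (pser R) (pser R) (dil d) (dil_is_zmod_morphism d).
HB.instance Definition _ d :=
  GRing.isMonoidMorphism.Build (pser R) (pser R) (dil d)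
    (dil_is_monoid_morphism d).

Lemma pcoef_dil d f n :
  dil d f n = if (d %| n)%N then f (n %/ d)%N else 0.
Proof. by []. Qed.
Lemma dilD d f g : dil d (f + g) = dil d f + dil d g.
Proof. exact: rmorphD. Qed.
Lemma dilB d f g : dil d (f - g) = dil d f - dil d g.
Proof. exact: rmorphB. Qed.
Lemma dilM d f g : dil d (f * g) = dil d f * dil d g.
Proof. exact: rmorphM. Qed.
Lemma dilX d f m : dil d (f ^+ m) = dil d f ^+ m.
Proof. exact: rmorphXn. Qed.
Lemma dilMn d f m : dil d (f *+ m) = dil d f *+ m.
Proof. exact: rmorphMn. Qed.
Definition dilE := (dilMn, dilX, dilB, dilD, dilM).

Lemma dil_q d : (0 < d)%N -> dil d q = q ^+ d.
Proof.
move=> d0; apply: pserP => n; rewrite pcoef_qX /=.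
case: dvdnP => [[k ->]|nd]; first by rewrite mulnK // -{2}[d]mul1n eqn_pmul2r.
by case: eqP => // nd'; case: nd; exists 1%N; rewrite mul1n.
Qed.

Lemma dil_dil d e f : (0 < d)%N -> dil d (dil e f) = dil (d * e) f.
Proof.
move=> d0; apply: pserP => n /=; rewrite -divnMA.
case: (boolP (d %| n)%N) => [/dvdnP[k ->]|nd].
  by rewrite mulnK // mulnC dvdn_pmul2l.
by case: ifP => // den; case/negP: nd; apply: dvdn_trans den; apply: dvdn_mulr.
Qed.

Lemma dil1 f : dil 1 f = f.
Proof. by apply: pserP => n; rewrite pcoef_dil dvd1n divn1. Qed.

Lemma pcoef_dil0 d f : dil d f 0%N = f 0%N.
Proof. by rewrite /= dvdn0 div0n. Qed.

Lemma qderiv_dil d f : qderiv (dil d f) = dil d (qderiv f) *+ d.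
Proof.
apply: pserP => n; rewrite pcoefMn /=; case: ifP => [/dvdnP[k ->]|_].
  case: d => [|d]; first by rewrite muln0 mulr0n.
  by rewrite mulnK // mulrnA.
by rewrite !mul0rn.
Qed.

(** The series f(-q). *)
Definition alt f : pser R := Pser (fun n => (-1) ^+ n * f n).

Fact alt_is_zmod_morphism : zmod_morphism alt.
Proof. by move=> f g; apply: pserP => n; rewrite /= mulrBr. Qed.
Fact alt_is_monoid_morphism : monoid_morphism alt.
Proof.
split=> [|f g]; apply: pserP => n /=.
  by case: n => [|n]; rewrite ?mulr1 ?mulr0.
rewrite big_distrr; apply: eq_bigr => i _ /=.
by rewrite mulrACA -exprD subnKC // -ltnS.
Qed.
HB.instance Definition _ :=
  GRing.isZmodMorphism.Build (pser R) (pser R) alt alt_is_zmod_morphism.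
HB.instance Definition _ :=
  GRing.isMonoidMorphism.Build (pser R) (pser R) alt alt_is_monoid_morphism.

Lemma pcoef_alt f n : alt f n = (-1) ^+ n * f n.
Proof. by []. Qed.

Lemma alt_q : alt q = - q.
Proof. by apply: pserP => -[|[|n]] /=; rewrite ?mulr0 ?oppr0 ?mulr1. Qed.

Definition sect d r f : pser R := Pser (fun n => f (d * n + r)%N).

Lemma sum_multiples d n r (F : nat -> R) : (r < d)%N ->
  \sum_(i < (d * n + r).+1) (if (d %| i)%N then F i else 0) =
  \sum_(l < n.+1) F (d * l)%N.
Proof.
move=> rd; have d0 : (0 < d)%N by apply: leq_ltn_trans rd.
elim: n r rd => [|n IH] r rd.
  rewrite muln0 add0n big_ord_recl big_ord1 dvdn0 muln0 big1 ?addr0 // => i _.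
  rewrite gtnNdvd //; exact: leq_ltn_trans (ltn_ord i) rd.
rewrite [RHS]big_ord_recr -(IH d.-1) ?prednK //.
have -> : (d * n.+1 + r).+1 = ((d * n + d.-1).+1 + r.+1)%N.
  by rewrite mulnS; lia.
rewrite big_split_ord /=; congr (_ + _).
have e j : ((d * n + d.-1).+1 + j = d * n.+1 + j)%N by rewrite mulnS; lia.
under eq_bigr => i _ do rewrite e.
rewrite big_ord_recl addn0 dvdn_mulr // big1 ?addr0 // => i _.
rewrite dvdn_addr ?dvdn_mulr // gtnNdvd //.
exact: leq_ltn_trans (ltn_ord i) rd.
Qed.

(** Multiplication by a series in q^d respects residue classes of exponents
    modulo d, so sections modulo d are linear over such series. *)
Lemma sect_dil d r f g : (r < d)%N -> sect d r (f * dil d g) = sect d r f * g.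
Proof.
move=> rd; apply: pserP => n; rewrite mulrC [sect d r f * g]mulrC !pcoefM /=.
have d0 : (0 < d)%N by apply: leq_ltn_trans rd.
pose F i := g (i %/ d)%N * f (d * n + r - i)%N.
transitivity (\sum_(i < (d * n + r).+1) (if (d %| i)%N then F i else 0)).
  by apply: eq_bigr => i _; case: ifP => // _; rewrite mul0r.
rewrite sum_multiples //; apply: eq_bigr => l _; rewrite /F mulKn //.
by congr (_ * f _); rewrite mulnBr addnBAC // leq_mul2l -ltnS ltn_ord orbT.
Qed.

Definition eq_upto N f g := forall n, (n <= N)%N -> f n = g n.

Lemma eq_uptoM N f f' g g' :
  eq_upto N f f' -> eq_upto N g g' -> eq_upto N (f * g) (f' * g').
Proof.
move=> ff gg n nN; rewrite !pcoefM; apply: eq_bigr => i _.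
by rewrite ff ?gg ?(leq_trans _ nN) ?leq_subr // -ltnS.
Qed.

Lemma eq_upto_dil N d f g : eq_upto N f g -> eq_upto N (dil d f) (dil d g).
Proof.
move=> fg n nN /=; case: ifP => // _; apply: fg.
exact: leq_trans (leq_div _ _) nN.
Qed.

Lemma eq_upto_alt N f g : eq_upto N f g -> eq_upto N (alt f) (alt g).
Proof. by move=> fg n nN /=; rewrite fg. Qed.

(** If d has order m >= 2 and p order 1, then d p has order m + 1 while
    r d(q^2) has order at least 2m > m + 1.  Uniqueness for the functional
    equations of theta series under q -> q^2 rests on this. *)
Lemma dil2_rigid d p r : d * p = r * dil 2 d ->
  p 0%N = 0 -> (forall x, x * p 1%N = 0 -> x = 0) ->
  d 0%N = 0 -> d 1%N = 0 -> d = 0.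
Proof.
move=> E p0 p1 d0 d1; apply: pserP => n.
suff: forall m, (m <= n)%N -> d m = 0 by apply.
elim: n => [|[|n] IH] m; first by rewrite leqn0 => /eqP->.
  by case: m => [|[|m]].
rewrite leq_eqVlt => /predU1P[-> {m}|/IH //].
apply: p1; have := congr1 (fun h : pser R => h n.+3) E; rewrite !pcoefM.
rewrite big_ord_recr /= subnn p0 mulr0 addr0 big_ord_recr /=.
rewrite big1 => [|i _]; last by rewrite IH ?mul0r // -ltnS.
have -> : (n.+3 - n.+2 = 1)%N by lia.
rewrite add0r => ->; apply: big1 => i _; case: ifP => _; last by rewrite mulr0.
rewrite IH ?mulr0 //; apply: leq_trans (leq_div2r _ (leq_subr _ _)) _; lia.
Qed.

Lemma dil2_fix h : dil 2 h = h -> forall n, (0 < n)%N -> h n = 0.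
Proof.
move=> E; elim/ltn_ind => n IH n0; rewrite -E /=; case: ifP => // /dvdnP[k nk].
by apply: IH; lia.
Qed.

End Ops.
Arguments qderiv : simpl never.
Arguments dil : simpl never.
Arguments alt : simpl never.

Lemma pser_pchar (R : comNzRingType) p :
  p \in [pchar R] -> p \in [pchar pser R].
Proof.
case/andP=> p_pr /eqP p0; apply/andP; split=> //; apply/eqP/pserP => n.
by rewrite pcoefMn pcoef1 -(mulr_natl _ p) p0 mul0r.
Qed.

(** Induction on the coefficient, writing f = f(0) + q g: the Frobenius map is
    additive and fixes f(0). *)
Lemma pser_Frobenius p (f : pser 'F_p) : prime p -> f ^+ p = dil p f.
Proof.
move=> p_pr; have pc := pser_pchar (pchar_Fp p_pr); have p0 := prime_gt0 p_pr.
apply: pserP => n; elim/ltn_ind: n f => n IH f.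
pose c : pser _ := Pser (fun n => if n is 0%N then f 0%N else 0).
pose g : pser _ := Pser (fun n => f n.+1).
have -> : f = c + q * g.
  by apply: pserP => -[|m]; rewrite pcoefD pcoef_qM /= ?addr0 ?add0r.
have cM (h : pser 'F_p) m : (c * h) m = f 0%N * h m.
  rewrite pcoefM big_ord_recl subn0 big1 ?addr0 // => i _; exact: mul0r.
have pp : [pchar pser 'F_p].-nat p by rewrite pnatE.
rewrite (exprDn_pchar _ _ pp) exprMn.
rewrite dilD dilM dil_q // !pcoefD !pcoef_qXM; congr (_ + _).
  have cX m k : (c ^+ m) k = if k is 0%N then f 0%N ^+ m else 0.
    elim: m k => [|m IHm] k; first by case: k.
    by rewrite exprS cM IHm [in RHS]exprS; case: k => // k; rewrite mulr0.
  rewrite cX; case: n {IH} => [|n].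
    rewrite pcoef_dil0 /= -[RHS](expf_card (f 0%N)) card_Fp //.
  by rewrite pcoef_dil; case: dvdnP => // -[[|k] // ->]; rewrite mulnK.
by case: ifP => // /negbT; rewrite -leqNgt => pn; apply: IH; lia.
Qed.

(** * A finite form of Gauss's identity *)

(** On the right the summand s = 0 is the product of the 1 - x^i and every
    other summand is divisible by x^(N+1), so the limit N -> oo is the infinite
    identity.  Calling T_N the right-hand side, T_n - (1 + x^n) T_(n-1) is its
    last summand plus a telescoping sum. *)
Lemma gauss_finite (R : comNzRingType) (x : R) N :
  (1 + \sum_(0 <= j < N) (-1) ^+ j.+1 * x ^+ (j.+1 ^ 2) *+ 2)
    * \prod_(0 <= i < N) (1 + x ^+ i.+1) =
  \sum_(0 <= s < N.+1) (-1) ^+ s * x ^+ (s * N.+1)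
     * \prod_(0 <= i < s) (1 + x ^+ i) * \prod_(s.+1 <= i < N.+1) (1 - x ^+ i).
Proof.
pose C s := \prod_(0 <= i < s) (1 + x ^+ i).
elim: N => [|N IH]; first by rewrite !big_nat1 !big_geq // !mulr1 addr0.
pose n := N.+1; pose D s := \prod_(s <= i < n) (1 - x ^+ i).
have CS s : C s.+1 = C s * (1 + x ^+ s) by rewrite /C big_nat_recr.
have C2 : C n.+1 = (\prod_(0 <= i < n) (1 + x ^+ i.+1)) *+ 2.
  by rewrite /C big_nat_recl // expr0 mulrDl mul1r mulr2n.
have DS s : (s < n)%N -> D s = (1 - x ^+ s) * D s.+1.
  by move=> sn; rewrite /D big_ltn.
(* For s < n, the summand of T_n minus 1 + x ^+ n times the summand of T_(n-1)
   is v s.+1 - v s; here v 0 = 0 because D 0 has the factor 1 - x ^+ 0. *)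
pose v s := (-1) ^+ s * C s * x ^+ (s * n) * D s.
have v0 : v 0%N = 0 by rewrite /v DS // expr0 subrr mul0r mulr0.
have vn : v n = (-1) ^+ n * C n * x ^+ (n * n).
  by rewrite /v /D big_geq // mulr1.
rewrite [\sum_(0 <= j < n) _]big_nat_recr //= addrA mulrDl.
rewrite [X in _ * X + _]big_nat_recr //= mulrA IH.
rewrite [RHS]big_nat_recr //= [\prod_(N.+2 <= _ < _) _]big_geq // mulr1.
rewrite mulrnAl -mulrnAr -C2.
pose t := \sum_(0 <= s < n) (v s.+1 - v s).
have tE : t = v n by rewrite /t telescope_sumr // v0 subr0.
suff -> : \sum_(0 <= i < n)
     (-1) ^+ i * x ^+ (i * n.+1) * \prod_(0 <= i0 < i) (1 + x ^+ i0) *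
     \prod_(i.+1 <= i0 < n.+1) (1 - x ^+ i0) =
  (\sum_(0 <= s < n)
     (-1) ^+ s * x ^+ (s * n) * \prod_(0 <= i < s) (1 + x ^+ i) *
     \prod_(s.+1 <= i < n) (1 - x ^+ i)) * (1 + x ^+ n) + t.
  rewrite -addrA tE vn CS -/(C n); congr (_ + _); rewrite mulnS -mulnn exprD.
  by rewrite exprS; ring.
rewrite big_distrl -big_split; apply: eq_big_nat => s /andP[_ sn] /=.
rewrite [\prod_(_ <= _ < n.+1) _]big_nat_recr //= -/(D _) -/(C _) /v CS.
by rewrite (DS s) // mulnS mulSn !exprD exprS; ring.
Qed.

(** * Euler products, theta series and their behaviour under q -> q^2 *)

Lemma leq_sqrD a b m : (a ^ 2 + b ^ 2 = m)%N -> (a <= m)%N.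
Proof.
move=> <-; apply: leq_trans (leq_addr _ _).
by case: a => // a; rewrite -mulnn leq_pmulr.
Qed.

Lemma sqr_abszE (x : int) : (`|x| ^ 2)%N%:Z = x * x.
Proof. by rewrite -abszX gez0_abs ?sqr_ge0 // expr2. Qed.

Lemma sqr_absz_add (x y : int) n :
  (`|x| ^ 2 + `|y| ^ 2 == n)%N = (x * x + y * y == n%:Z).
Proof. by rewrite -eqz_nat PoszD !sqr_abszE. Qed.

Section Euler.
Variable R : comNzRingType.
Implicit Types f g h : pser R.

Definition pser_of_poly (p : {poly int}) : pser R := Pser (fun n => (p`_n)%:~R).

Fact pser_of_poly_is_zmod_morphism : zmod_morphism pser_of_poly.
Proof. by move=> f g; apply: pserP => n; rewrite /= coefB rmorphB. Qed.
Fact pser_of_poly_is_monoid_morphism : monoid_morphism pser_of_poly.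
Proof.
split=> [|f g]; apply: pserP => n /=; first by rewrite coef1; case: eqP.
rewrite coefM rmorph_sum; apply: eq_bigr => i _; exact: rmorphM.
Qed.
HB.instance Definition _ := GRing.isZmodMorphism.Build {poly int} (pser R)
  pser_of_poly pser_of_poly_is_zmod_morphism.
HB.instance Definition _ := GRing.isMonoidMorphism.Build {poly int} (pser R)
  pser_of_poly pser_of_poly_is_monoid_morphism.

Lemma pser_of_polyX : pser_of_poly 'X = q.
Proof. by apply: pserP => n /=; rewrite coefX; case: eqP. Qed.

Definition euler : pser R := Pser (fun n => (qpoch 'X 'X n)%:~R).

Lemma euler_eq_upto N : eq_upto N euler (\prod_(0 <= i < N) (1 - q ^+ i.+1)).
Proof.
move=> n nN; rewrite /euler /= (@qpochE 'X 'X n N) ?coefX // big_mkord.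
have -> : \prod_(i < N) (1 - q ^+ i.+1) =
    pser_of_poly (\prod_(i < N) (1 - 'X * 'X ^+ i)).
  rewrite rmorph_prod; apply: eq_bigr => i _.
  by rewrite rmorphB rmorph1 -exprS rmorphXn /= pser_of_polyX.
by [].
Qed.

Lemma euler_coef0 : euler 0%N = 1.
Proof. by rewrite (euler_eq_upto (leqnn 0)) big_geq. Qed.

Lemma qpoch_dil m n : (0 < m)%N -> (qpoch 'X^m 'X^m n)%:~R = dil m euler n.
Proof.
move=> m0; rewrite pcoef_dil /qpoch.
have -> : \prod_(i < n.+1) (1 - 'X^m * 'X^m ^+ i) =
    (\prod_(i < n.+1) (1 - 'X * 'X ^+ i)) \Po 'X^m :> {poly int}.
  rewrite rmorph_prod; apply: eq_bigr => i _.
  by rewrite /= rmorphB rmorph1 rmorphM rmorphXn /= comp_polyX.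
rewrite coef_comp_poly_Xn //; case: ifP => // _.
by rewrite /euler /= (@qpochE _ _ _ n.+1) ?coefX // ltnW // ltnS leq_div.
Qed.

Fixpoint int_box N : seq int :=
  if N is M.+1 then (N%:Z) :: (- N%:Z) :: int_box M else [:: 0].

Lemma mem_int_box N x : (x \in int_box N) = (`|x| <= N)%N.
Proof.
elim: N => [|N IH]; first by rewrite inE; apply/eqP/idP; lia.
by rewrite !inE IH; apply/idP/idP; lia.
Qed.

Lemma int_box_uniq N : uniq (int_box N).
Proof. by elim: N => //= N ->; rewrite !inE !mem_int_box; lia. Qed.

(** The sum of q^(x^2) over the integers x.  The box of radius n contains all
    solutions of x^2 = n. *)
Definition theta3 : pser R :=
  Pser (fun n => (count (fun x => `|x| ^ 2 == n)%N (int_box n))%:R).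

Lemma theta3_box N n : (n <= N)%N ->
  theta3 n = (count (fun x => `|x| ^ 2 == n)%N (int_box N))%:R.
Proof.
move=> nN; rewrite /theta3 /= -!size_filter; congr (_%:R); apply: perm_size.
apply: uniq_perm; rewrite ?filter_uniq ?int_box_uniq // => x.
rewrite !mem_filter !mem_int_box; case: eqP => //= xn.
have xle : (`|x| <= n)%N by apply: (@leq_sqrD _ 0); rewrite addn0.
by rewrite xle (leq_trans xle).
Qed.

Lemma theta3_eq_upto N :
  eq_upto N theta3 (1 + \sum_(0 <= j < N) q ^+ (j.+1 ^ 2) *+ 2).
Proof.
move=> n nN; rewrite (theta3_box nN).
elim: N {nN} => [|N IH].
  by rewrite big_geq // addr0 /= eq_sym addn0; case: n.
rewrite big_nat_recr // addrA pcoefD -IH pcoefMn pcoef_qX [int_box _]/= /=.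
by rewrite !natrD [n == _]eq_sym; ring.
Qed.

(** With Q the product of the 1 + q^i, i >= 1, one has E_2 = E_1 Q, so the
    claim reads theta4 Q = E_1, the limit of gauss_finite. *)
Theorem gauss_theta4 : alt theta3 * dil 2 euler = euler ^+ 2.
Proof.
apply: pserP => N.
pose P := \prod_(0 <= i < N) (1 - q ^+ i.+1) : pser R.
pose Q := \prod_(0 <= i < N) (1 + q ^+ i.+1) : pser R.
pose S := 1 + \sum_(0 <= j < N) (-1) ^+ j.+1 * q ^+ (j.+1 ^ 2) *+ 2 : pser R.
have aS : eq_upto N (alt theta3) S.
  have -> : S = alt (1 + \sum_(0 <= j < N) q ^+ (j.+1 ^ 2) *+ 2).
    rewrite rmorphD rmorph1 rmorph_sum; congr (_ + _); apply: eq_bigr => j _ /=.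
    rewrite rmorphMn rmorphXn /= alt_q [(- q) ^+ _]exprNn; congr (_ * _ *+ _).
    by rewrite -[in RHS]signr_odd oddX signr_odd.
  by apply: eq_upto_alt; apply: theta3_eq_upto.
have eP : eq_upto N euler P := @euler_eq_upto N.
have ePQ : eq_upto N (dil 2 euler) (P * Q).
  have -> : P * Q = dil 2 P.
    rewrite /P /Q -big_split rmorph_prod; apply: eq_bigr => i _ /=.
    rewrite rmorphB rmorph1 rmorphXn /= dil_q // exprAC.
    by move: (q ^+ i.+1) => x; ring.
  exact: eq_upto_dil.
have SQ : eq_upto N (S * Q) P.
  rewrite /S /Q gauss_finite => n nN; rewrite big_nat_recl //.
  rewrite [\prod_(0 <= _ < 0) _]big_geq // pcoefD pcoef_sum.
  rewrite [X in _ + X]big1_seq => [|s _].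
    by rewrite addr0 !mul1r /P big_add1.
  rewrite -!mulrA mulrCA pcoef_qXM ifT // mulSn; lia.
rewrite (eq_uptoM aS ePQ (leqnn N)) mulrCA.
rewrite (eq_uptoM (f := P) (f' := P) _ SQ (leqnn N)) //.
by rewrite expr2 (eq_uptoM eP eP (leqnn N)).
Qed.

Lemma theta3_mul_box N n : (n <= N)%N ->
  (theta3 * theta3) n =
  (count (fun z : int * int => `|z.1| ^ 2 + `|z.2| ^ 2 == n)%N
     [seq (x, y) | x <- int_box N, y <- int_box N])%:R.
Proof.
have cE (T : Type) (P : pred T) (s : seq T) :
    (count P s)%:R = \sum_(x <- s) (P x)%:R :> R.
  by rewrite -sumn_count sumnE big_map natr_sum.
move=> nN; rewrite cE big_allpairs_dep pcoefM.
transitivity (\sum_(i < n.+1) \sum_(x <- int_box N) \sum_(y <- int_box N)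
    ((`|x| ^ 2 == i)%N * (`|y| ^ 2 == n - i)%N)%:R : R).
  apply: eq_bigr => i _; rewrite (@theta3_box N) ?(leq_trans _ nN) -1?ltnS //.
  rewrite (@theta3_box N (n - i)) ?(leq_trans _ nN) ?leq_subr // !cE big_distrl.
  apply: eq_bigr => x _; rewrite big_distrr.
  by apply: eq_bigr => y _; rewrite natrM.
rewrite exchange_big; apply: eq_bigr => x _; rewrite exchange_big.
apply: eq_bigr => y _ /=; rewrite -natr_sum; congr _%:R.
have [le|gt] := leqP (`|x| ^ 2) n.
  rewrite (bigD1 (Ordinal (le : (_ < n.+1)%N))) //= eqxx mul1n big1 ?addn0.
    by congr nat_of_bool; apply/eqP/eqP; lia.
  by move=> i /eqP ne; case: eqP => // xi; case: ne; apply: val_inj.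
rewrite big1 => [|i _]; first by case: eqP => //; lia.
by case: eqP => // xi; have := ltn_ord i; lia.
Qed.

(** The map (u, v) -> (u + v, u - v) is a bijection from representations of m
    as a sum of two squares onto those of 2m: in x^2 + y^2 = 2m the two
    squares have the same parity. *)
Lemma two_squares_double m :
  (theta3 * theta3) (2 * m)%N = (theta3 * theta3) m.
Proof.
rewrite (@theta3_mul_box (2 * m)%N) //.
rewrite (@theta3_mul_box (2 * m)%N m) ?leq_pmull // -!size_filter.
rewrite -[in RHS](size_map (fun z : int * int => (z.1 + z.2, z.1 - z.2))).
congr _%:R; apply: perm_size; apply: uniq_perm.
- rewrite filter_uniq // allpairs_uniq ?int_box_uniq //.
  by move=> [? ?] [? ?] _ _ [-> ->].
- rewrite map_inj_uniq ?filter_uniq ?allpairs_uniq ?int_box_uniq //.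
    by move=> [? ?] [? ?] _ _ [-> ->].
  by move=> [x y] [x' y'] [/= e1 e2]; congr pair; lia.
have mem_box N (x y : int) :
    ((x, y) \in [seq (x, y) | x <- int_box N, y <- int_box N])
    = (`|x| <= N)%N && (`|y| <= N)%N.
  rewrite -!mem_int_box; apply/allpairsP/andP => [|[? ?]].
    by move=> [[a b] [/= ? ? [-> ->]]].
  by exists (x, y).
move=> [x y]; rewrite mem_filter mem_box /=; apply/idP/mapP.
  rewrite sqr_absz_add => /andP[/eqP xy _].
  have [u [v [ex ey]]] : exists u v : int, x = u + v /\ y = u - v.
    pose k := ((x + y) %/ 2)%Z.
    have [e|e] : y = 2 * k - x \/ y = 2 * k + 1 - x by lia.
      by exists k, (x - k); split; lia.
    (* x + y is odd: then x^2 + y^2 is odd, and cannot be 2m. *)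
    exfalso; rewrite e in xy.
    have : 2 * (x * x - (2 * k + 1) * x + 2 * k * k + 2 * k - m%:Z) = - 1.
      rewrite [LHS](_ : _ = x * x + (2 * k + 1 - x) * (2 * k + 1 - x) - 1
        - 2 * m%:Z); last by ring.
      by rewrite xy PoszM; ring.
    by lia.
  exists (u, v); last by rewrite ex ey.
  have uv : (`|u| ^ 2 + `|v| ^ 2)%N = m.
    apply/eqP; rewrite sqr_absz_add; apply/eqP.
    have : 2 * (u * u + v * v) = 2 * m%:Z by rewrite -PoszM -xy ex ey; ring.
    by lia.
  have m2 : (m <= 2 * m)%N by rewrite leq_pmull.
  rewrite mem_filter mem_box /= uv eqxx (leq_trans (leq_sqrD uv)) //.
  by rewrite addnC in uv; rewrite (leq_trans (leq_sqrD uv)).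
case=> [[u v]]; rewrite mem_filter mem_box /= => /andP[/eqP uv _] [-> ->].
have e : (`|(u + v)%R| ^ 2 + `|(u - v)%R| ^ 2)%N = (2 * m)%N.
  apply/eqP; rewrite sqr_absz_add -uv PoszM PoszD !sqr_abszE; apply/eqP; ring.
by rewrite e eqxx (leq_sqrD e); rewrite addnC in e; rewrite (leq_sqrD e).
Qed.

Lemma theta3_sqr_add_theta4_sqr :
  theta3 ^+ 2 + alt theta3 ^+ 2 = dil 2 theta3 ^+ 2 *+ 2.
Proof.
rewrite -rmorphXn -dilX !expr2.
apply: pserP => n; rewrite pcoefD pcoefMn pcoef_dil pcoef_alt.
rewrite -signr_odd; case: dvdnP => [[m ->]|nd].
  by rewrite mulnK // mulnC two_squares_double mul2n odd_double mul1r mulr2n.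
have -> : odd n = true.
  by apply/negPn/negP => /even_halfK e; case: nd; exists n./2; rewrite muln2 e.
by rewrite mulN1r subrr mul0rn.
Qed.

(** The terms of even exponent in theta3 are those with x even, and they form
    theta3(q^4). *)
Lemma theta3_add_theta4 : theta3 + alt theta3 = dil 4 theta3 *+ 2.
Proof.
apply: pserP => n; rewrite pcoefD pcoefMn pcoef_dil pcoef_alt.
rewrite -signr_odd.
have sq (k : nat) : theta3 (4 * k)%N = theta3 k.
  rewrite (@theta3_box (4 * k)%N) // (@theta3_box (4 * k)%N k) ?leq_pmull //.
  rewrite -!size_filter -[in RHS](size_map (fun x : int => 2 * x)); congr _%:R.
  apply: perm_size; apply: uniq_perm.
  - by rewrite filter_uniq ?int_box_uniq.
  - by rewrite map_inj_uniq ?filter_uniq ?int_box_uniq // => x y; lia.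
  move=> x; rewrite mem_filter mem_int_box; apply/idP/mapP.
    case/andP=> /eqP xk xb.
    have [y ex] : exists y : int, x = 2 * y.
      exists (x %/ 2)%Z; have := congr1 odd xk.
      by rewrite oddX oddM /=; lia.
    exists y; last exact: ex.
    have yk : (`|y| ^ 2)%N = k.
      by move: xk; rewrite ex abszM expnMn; lia.
    rewrite mem_filter mem_int_box yk eqxx /=.
    by apply: leq_trans (@leq_sqrD _ 0 k _) (leq_pmull _ _); rewrite ?addn0.
  case=> y; rewrite mem_filter mem_int_box => /andP[/eqP yk yb] ->.
  have e : (`|(2 * y)%R| ^ 2)%N = (4 * k)%N by rewrite abszM expnMn yk.
  by rewrite e eqxx; apply: (@leq_sqrD _ 0); rewrite addn0.
have sq0 : ~~ odd n -> ~~ (4 %| n)%N -> theta3 n = 0.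
  move=> on dn; rewrite /theta3 /=.
  rewrite (@eq_count _ _ pred0) ?count_pred0 // => x /=.
  apply/negbTE/eqP => xn; have [k e] : exists k, (`|x| = 2 * k)%N.
    by exists (`|x|./2); rewrite -xn oddX /= in on; lia.
  by case/negP: dn; rewrite -xn e expnMn dvdn_mulr.
case: (boolP (4 %| n)%N) => [/dvdnP[k ->]|nd].
  by rewrite mulnK // mulnC sq oddM /= mul1r mulr2n.
case: (boolP (odd n)) => on; first by rewrite mulN1r subrr mul0rn.
by rewrite sq0 // mulr0 addr0 mul0rn.
Qed.

End Euler.

(** * Product formula and derivative of the quartic theta identity *)

Section Thetas.
Variable R : comNzRingType.
Hypothesis double_eq0 : forall x : R, x *+ 2 = 0 -> x = 0.

Local Notation E d := (dil d (euler R)).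
Local Notation a := (theta3 R).
Local Notation b := (alt (theta3 R)).
Local Notation a2 := (dil 2 a).
Local Notation b2 := (dil 2 b).

Lemma pser_double_inj (f g : pser R) : f *+ 2 = g *+ 2 -> f = g.
Proof.
move=> fg; apply/pserP => n; apply/eqP; rewrite -subr_eq0; apply/eqP/double_eq0.
by rewrite mulrnBl -!pcoefMn fg subrr.
Qed.

Lemma pcoef_theta3_0 : a 0%N = 1. Proof. by []. Qed.
Lemma pcoef_theta3_1 : a 1%N = 2. Proof. by []. Qed.

Lemma pcoefX1 (f : pser R) m : f 0%N = 1 -> (f ^+ m) 1%N = f 1%N *+ m.
Proof.
move=> f0; elim: m => [|m IH] //.
by rewrite exprS pcoefM1 IH f0 pcoefX0 f0 expr1n mul1r mulr1 -mulrSr.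
Qed.

Fact dil2_dil1 (f : pser R) : dil 2 (dil 1 f) = dil 2 f.
Proof. exact: dil_dil. Qed.
Fact dil2_dil2 (f : pser R) : dil 2 (dil 2 f) = dil 4 f.
Proof. exact: dil_dil. Qed.
Fact dil2_dil4 (f : pser R) : dil 2 (dil 4 f) = dil 8 f.
Proof. exact: dil_dil. Qed.
Definition dil2E := (dilE, dil2_dil1, dil2_dil2, dil2_dil4).

(** Expand (a + b)^2 using a + b = 2 a(q^4) and a^2 + b^2 = 2 a(q^2)^2, the
    latter both at q and at q^2. *)
Lemma theta3_mul_theta4 : a * b = b2 ^+ 2.
Proof.
have s := theta3_sqr_add_theta4_sqr R; have p := theta3_add_theta4 R.
have := congr1 (dil 2) s; rewrite !dil2E => s2.
apply: pser_double_inj; move: s p s2.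
move: a b a2 b2 (dil 4 a) => x y x2 y2 c s p s2.
transitivity ((x + y) ^+ 2 - (x ^+ 2 + y ^+ 2)); first by ring.
by rewrite s p; transitivity ((c ^+ 2 *+ 2) *+ 2 - x2 ^+ 2 *+ 2);
   [ring | rewrite -s2; ring].
Qed.

Lemma theta3_euler : a * E 1 ^+ 2 * E 4 ^+ 2 = E 2 ^+ 5.
Proof.
rewrite [E 1]dil1.
have g := gauss_theta4 R; have := congr1 (dil 2) g; rewrite !dil2E => g2.
rewrite -g; transitivity (a * b * E 2 * E 4 ^+ 2); first by ring.
rewrite theta3_mul_theta4; transitivity ((b2 * E 4) ^+ 2 * E 2); first by ring.
by rewrite g2; ring.
Qed.

Lemma quartics_dil2 : (a2 ^+ 4 - b2 ^+ 4) *+ 4 = (a ^+ 2 - b ^+ 2) ^+ 2.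
Proof.
have s := theta3_sqr_add_theta4_sqr R; have m := theta3_mul_theta4.
transitivity ((a2 ^+ 2 *+ 2) ^+ 2 - b2 ^+ 2 * b2 ^+ 2 *+ 4); first by ring.
by rewrite -s -m; ring.
Qed.

Lemma pcoef_theta4_0 : b 0%N = 1. Proof. by rewrite pcoef_alt mul1r. Qed.
Lemma pcoef_theta4_1 : b 1%N = - 2%:R. Proof. by rewrite pcoef_alt mulN1r. Qed.

Lemma pcoef_euler0 d : E d 0%N = 1.
Proof. by rewrite pcoef_dil0 euler_coef0. Qed.

Lemma double_pow_eq0 m (x : R) : x *+ (2 ^ m) = 0 -> x = 0.
Proof. by elim: m => // m IH; rewrite expnSr mulrnA => /double_eq0. Qed.

Lemma quartic_coef0 : (a ^+ 4 - b ^+ 4) 0%N = 0.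
Proof.
by rewrite pcoefD pcoefN !pcoefX0 pcoef_theta4_0 pcoef_theta3_0 subrr.
Qed.
Lemma quartic_coef1 : (a ^+ 4 - b ^+ 4) 1%N = 16.
Proof.
rewrite pcoefD pcoefN !pcoefX1 ?pcoef_theta4_0 ?pcoef_theta3_0 //.
by rewrite pcoef_theta4_1 pcoef_theta3_1; ring.
Qed.

(** In Jacobi's notation this is theta3^4 - theta4^4 = theta2^4 combined with
    the product for theta2.  Both sides Z begin with 16 q and satisfy
    Z^2 E_8^8 = 16 Z(q^2) E_4^16, so dil2_rigid applies to their difference. *)
Lemma quartic_product : (a ^+ 4 - b ^+ 4) * E 2 ^+ 4 = q * E 4 ^+ 8 *+ 16.
Proof.
pose U := (a ^+ 4 - b ^+ 4) * E 2 ^+ 4; pose V := q * E 4 ^+ 8 *+ 16 : pser R.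
have dU : U ^+ 2 * E 8 ^+ 8 = dil 2 U * E 4 ^+ 16 *+ 16.
  have ea := congr1 (dil 2) theta3_euler; rewrite !dil2E in ea.
  have s := theta3_sqr_add_theta4_sqr R.
  rewrite /U !dil2E.
  transitivity ((a2 ^+ 4 - b2 ^+ 4) *+ 4 * (a2 ^+ 2 *+ 2) ^+ 2 *
    E 2 ^+ 8 * E 8 ^+ 8).
    by rewrite quartics_dil2 -s; ring.
  transitivity ((a2 ^+ 4 - b2 ^+ 4) * (a2 * E 2 ^+ 2 * E 8 ^+ 2) ^+ 4 *+ 16).
    by ring.
  by rewrite ea; ring.
have dV : V ^+ 2 * E 8 ^+ 8 = dil 2 V * E 4 ^+ 16 *+ 16.
  by rewrite /V !dil2E dil_q //=; ring.
apply/eqP; rewrite -subr_eq0; apply/eqP; rewrite -/U -/V.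
have U0 : U 0%N = 0 by rewrite pcoefM0 quartic_coef0 mul0r.
have V0 : V 0%N = 0 by rewrite pcoefMn pcoefM0 mul0r mul0rn.
have U1 : U 1%N = 16.
  rewrite pcoefM1 quartic_coef0 quartic_coef1 pcoefX0 pcoef_euler0 expr1n.
  by ring.
have V1 : V 1%N = 16.
  by rewrite pcoefMn pcoefM1 pcoefX0 pcoef_euler0 expr1n mul0r mulr1 add0r.
clearbody U V.
apply: (@dil2_rigid _ _ ((U + V) * E 8 ^+ 8) (E 4 ^+ 16 *+ 16)).
- rewrite dilB mulrBr; transitivity (U ^+ 2 * E 8 ^+ 8 - V ^+ 2 * E 8 ^+ 8).
    by ring.
  by rewrite dU dV; ring.
- by rewrite pcoefM0 pcoefD U0 V0 addr0 mul0r.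
- move=> x; rewrite pcoefM1 !pcoefD U0 V0 U1 V1.
  rewrite pcoefX0 pcoef_euler0 expr1n => e.
  by apply: (@double_pow_eq0 5); rewrite -[RHS]e; ring.
- by rewrite pcoefD pcoefN U0 V0 subrr.
- by rewrite pcoefD pcoefN U1 V1 subrr.
Qed.

(** This is D log(a/b) = (a^4 - b^4) / 4 with denominators cleared.
    Differentiating the two doubling formulas shows that both sides Z satisfy
    8 a(q^2) b(q^2) Z(q^2) = (a^2 - b^2) Z, and both begin with 16 q. *)
Lemma theta_wronskian :
  (b * qderiv a - a * qderiv b) *+ 4 = a * b * (a ^+ 4 - b ^+ 4).
Proof.
pose W := b * qderiv a - a * qderiv b.
have s := theta3_sqr_add_theta4_sqr R; have m := theta3_mul_theta4.
have s' : dil 2 (qderiv a) * a2 *+ 4 = a * qderiv a + b * qderiv b.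
  apply: pser_double_inj; have := congr1 (@qderiv R) s.
  rewrite !qderivE !qderiv_dil /=.
  by rewrite !expr1 => e; transitivity (a * qderiv a *+ 2 + b * qderiv b *+ 2);
    [rewrite e; ring | ring].
have m' : dil 2 (qderiv b) * b2 *+ 4 = qderiv a * b + a * qderiv b.
  have := congr1 (@qderiv R) m.
  by rewrite !qderivE !qderiv_dil /= expr1 => ->; ring.
have dW : a2 * b2 * dil 2 W *+ 8 = (a ^+ 2 - b ^+ 2) * W.
  rewrite /W !dilE.
  transitivity (b2 ^+ 2 * (dil 2 (qderiv a) * a2 *+ 4) *+ 2
     - (a2 ^+ 2 *+ 2) * (dil 2 (qderiv b) * b2 *+ 4)); first by ring.
  by rewrite s' m' -s -m; ring.
apply/eqP; rewrite -subr_eq0; apply/eqP; rewrite -/W.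
set T := a * b * _.
have dT : a2 * b2 * dil 2 T *+ 8 = (a ^+ 2 - b ^+ 2) * T.
  rewrite /T !dilE.
  transitivity ((a2 ^+ 2 *+ 2) * b2 ^+ 2 * ((a2 ^+ 4 - b2 ^+ 4) *+ 4)).
    by ring.
  by rewrite quartics_dil2 -s -m; ring.
have ta0 (f : pser R) : qderiv f 0%N = 0 by rewrite /= mulr0n.
have ta1 (f : pser R) : qderiv f 1%N = f 1%N by rewrite /= mulr1n.
apply: (@dil2_rigid _ _ (a ^+ 2 - b ^+ 2) (a2 * b2 *+ 8)).
- transitivity (((a ^+ 2 - b ^+ 2) * W) *+ 4 - (a ^+ 2 - b ^+ 2) * T).
    by ring.
  by rewrite -dW -dT !dilE; ring.
- by rewrite pcoefD pcoefN !pcoefX0 pcoef_theta4_0 pcoef_theta3_0 subrr.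
- move=> x; rewrite pcoefD pcoefN !pcoefX1 ?pcoef_theta4_0 ?pcoef_theta3_0 //.
  rewrite pcoef_theta4_1 pcoef_theta3_1 => e.
  by apply: (@double_pow_eq0 3); rewrite -[RHS]e; ring.
- rewrite pcoefD pcoefN pcoefMn pcoefD pcoefN !pcoefM0 !ta0 quartic_coef0; ring.
- rewrite pcoefD pcoefN pcoefMn pcoefD pcoefN !pcoefM1 !ta0 !ta1.
  rewrite quartic_coef0 quartic_coef1 !pcoefM0 pcoef_theta4_0 pcoef_theta4_1.
  by rewrite pcoef_theta3_0 pcoef_theta3_1; ring.
Qed.

End Thetas.

(** * The Hasse invariant in characteristic 7 *)

Local Notation K := (pser 'F_7).

Lemma seven0 : 7 = 0 :> K.
Proof. by apply/eqP; have /andP[] := pser_pchar (pchar_Fp (isT : prime 7)). Qed.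

(** Each polynomial identity in characteristic 7 below is certified by a
    cofactor c for which it holds as an identity over the integers. *)
Lemma eq_mod7 (c x y : K) : x = y + 7 * c -> x = y.
Proof. by rewrite seven0 mul0r addr0. Qed.

Lemma F7_double_eq0 (x : 'F_7) : x *+ 2 = 0 -> x = 0.
Proof.
move/(congr1 (fun y => y *+ 4)); rewrite -mulrnA mul0rn -[(2 * 4)%N]/(7 + 1)%N.
by rewrite mulrnDr mulrn_pchar ?add0r // pchar_Fp.
Qed.

Local Notation E d := (dil d (euler 'F_7)).
Local Notation a := (theta3 'F_7).
Local Notation b := (alt (theta3 'F_7)).

Lemma pcoefM_eq1 (f g : K) : f 0%N = 1 -> g 0%N = 1 -> (f * g) 0%N = 1.
Proof. by move=> f0 g0; rewrite pcoefM0 f0 g0 mulr1. Qed.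

Lemma pcoefX_eq1 (f : K) m : f 0%N = 1 -> (f ^+ m) 0%N = 1.
Proof. by move=> f0; rewrite pcoefX0 f0 expr1n. Qed.

Lemma pcoef_eulers0 i j m n : (E i ^+ m * E j ^+ n) 0%N = 1.
Proof. by apply: pcoefM_eq1; apply: pcoefX_eq1; apply: pcoef_euler0. Qed.

(** Up to sign the left-hand side is the Eisenstein series E_6 modulo 7.  The
    doubling formulas write its value at q^2 as another polynomial in a and b,
    which turns out to be the same modulo 7.  So the series is unchanged by
    q -> q^2, hence constant. *)
Lemma hasse_theta :
  (a ^+ 4) ^+ 3 + (a ^+ 4) ^+ 2 * b ^+ 4 *+ 2 + a ^+ 4 * (b ^+ 4) ^+ 2 *+ 2
  + (b ^+ 4) ^+ 3 = - 1.
Proof.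
set h := (X in X = _).
have hdil : dil 2 h = h.
  have s := theta3_sqr_add_theta4_sqr 'F_7.
  have m := theta3_mul_theta4 F7_double_eq0.
  have a2 : dil 2 a ^+ 4 = (a ^+ 2 + b ^+ 2) ^+ 2 *+ 2.
    by rewrite s; apply: (@eq_mod7 (- dil 2 a ^+ 4)); ring.
  have b2 : dil 2 b ^+ 4 = (a * b) ^+ 2 by rewrite m; ring.
  rewrite /h !dilE a2 b2; move: a b => x y.
  apply: (@eq_mod7 (x ^+ 12 + 8 * x ^+ 10 * y ^+ 2 + 22 * x ^+ 8 * y ^+ 4
    + 31 * x ^+ 6 * y ^+ 6 + 22 * x ^+ 4 * y ^+ 8 + 8 * x ^+ 2 * y ^+ 10
    + y ^+ 12)).
  by ring.
apply/pserP => -[|n]; last first.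
  by rewrite (dil2_fix hdil) // pcoefN pcoef1 oppr0.
rewrite /h !(pcoefD, pcoefMn, pcoefX0, pcoefM0).
rewrite pcoef_theta4_0 pcoef_theta3_0 !expr1n !mulr1.
by apply/eqP.
Qed.

(** The series 2 P(q^2) - P(q), where P = 1 - 24 (q + 3 q^2 + ...) is the
    Eisenstein series of weight 2. *)
Definition eisenstein2 : K := a ^+ 4 *+ 2 - b ^+ 4.
(** The weight 4 form q E_2^16 / E_1^8 (see formY_euler), which over the
    rationals is a^4 (a^4 - b^4) / 16; here 1/16 is 4. *)
Definition formY : K := a ^+ 4 * (a ^+ 4 - b ^+ 4) *+ 4.
Local Notation A := eisenstein2.
Local Notation Y := formY.
Local Notation u := (eisenstein2 ^+ 2).
Local Notation X := (eisenstein2 ^+ 2 - formY).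

Lemma formX_theta4 : X = b ^+ 8.
Proof. by rewrite /A /Y; ring. Qed.

Lemma hasse_AY : A * (u - Y *+ 2) = 1.
Proof.
have h := hasse_theta; rewrite -[1]opprK -h /A /Y.
move: (a ^+ 4) (b ^+ 4) => p r.
by apply: (@eq_mod7 (- p ^+ 3 + 2 * p ^+ 2 * r)); ring.
Qed.

Local Notation cubic p r :=
  (p ^+ 3 + p ^+ 2 * r *+ 2 + p * r ^+ 2 *+ 2 + r ^+ 3).

(** The derivative of the Hasse relation and the Wronskian relation form a
    linear system for the two derivatives.  Its determinant is -3 times the
    cubic form, which the Hasse relation makes a unit. *)
Lemma solve_derivatives (p r dp dr : K) : cubic p r = - 1 ->
  (p ^+ 2 *+ 3 + p * r *+ 4 + r ^+ 2 *+ 2) * dp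
    + (p ^+ 2 *+ 2 + p * r *+ 4 + r ^+ 2 *+ 3) * dr = 0 ->
  r * dp - p * dr = p * r * (p - r) ->
  dr = p * r * (p - r) * (p ^+ 2 *+ 3 + p * r *+ 4 + r ^+ 2 *+ 2) *+ 5.
Proof.
set l := p ^+ 2 *+ 3 + _ + _; set m := p ^+ 2 *+ 2 + _ + _ => h dh w.
have dr3 : dr *+ 3 = p * r * (p - r) * l.
  transitivity (p * r * (p - r) * l - r * (l * dp + m * dr)); last first.
    by rewrite dh mulr0 subr0.
  transitivity (- (dr *+ 3) * - 1); first by ring.
  by rewrite -h -w /l /m; ring.
by apply: (@eq_mod7 (- dr *+ 2)); rewrite -dr3; ring.
Qed.

Lemma qderiv_quartics :
  qderiv (b ^+ 4) = a ^+ 4 * b ^+ 4 * (a ^+ 4 - b ^+ 4)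
    * ((a ^+ 4) ^+ 2 *+ 3 + a ^+ 4 * b ^+ 4 *+ 4 + (b ^+ 4) ^+ 2 *+ 2) *+ 5
  /\ b ^+ 4 * qderiv (a ^+ 4) - a ^+ 4 * qderiv (b ^+ 4) =
    a ^+ 4 * b ^+ 4 * (a ^+ 4 - b ^+ 4).
Proof.
have w : b ^+ 4 * qderiv (a ^+ 4) - a ^+ 4 * qderiv (b ^+ 4) =
    a ^+ 4 * b ^+ 4 * (a ^+ 4 - b ^+ 4).
  rewrite !qderivX /=; transitivity
    (a ^+ 3 * b ^+ 3 * ((b * qderiv a - a * qderiv b) *+ 4)); first by ring.
  by rewrite theta_wronskian; [ring | exact: F7_double_eq0].
split; last exact: w.
apply: solve_derivatives w; first exact: hasse_theta.
have := congr1 (@qderiv _) hasse_theta; rewrite raddfN /= qderiv1 oppr0 => <-.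
move: (a ^+ 4) (b ^+ 4) => p r; rewrite !qderivE /= !expr1; ring.
Qed.

(** Multiplying by suitable powers of the Hasse invariant makes both
    derivatives homogeneous, of weight 8 more than A and Y: this is the
    operator theta on modular forms modulo 7. *)
Lemma qderiv_AY : qderiv A = A * Y * X *+ 3 /\
  qderiv Y = Y * (u ^+ 2 + u * Y *+ 3 + Y ^+ 2 *+ 3).
Proof.
have [tb w] := qderiv_quartics; have h := hasse_theta.
rewrite /A /Y !(qderivMn, qderivB) [qderiv (_ * (_ - _))]qderivM !qderivB.
have : (b ^+ 4) 0%N = 1 by rewrite pcoefX0 pcoef_theta4_0 expr1n.
move: (qderiv (a ^+ 4)) (qderiv (b ^+ 4)) tb w.
move: (a ^+ 4) (b ^+ 4) h => p r h dp dr tb w r0.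
set l := p ^+ 2 *+ 3 + _ + _ in tb.
have ta : dp = p ^+ 2 * (p - r) * l *+ 5 - p * (p - r) * cubic p r.
  apply: (mulI_coef0 r0); rewrite h; transitivity (p * dr + p * r * (p - r)).
    by rewrite -w; ring.
  by rewrite tb; ring.
split.
  apply: (@eq_mod7 (4 * p ^+ 5 - p ^+ 4 * r - 7 * p ^+ 3 * r ^+ 2
    + 4 * p ^+ 2 * r ^+ 3)).
  by rewrite ta tb /l; ring.
apply: (@eq_mod7 (- 48 * p ^+ 6 + 180 * p ^+ 5 * r - 220 * p ^+ 4 * r ^+ 2
  + 88 * p ^+ 3 * r ^+ 3)).
by rewrite ta tb /l; ring.
Qed.

Lemma formY_euler : Y * E 1 ^+ 8 = q * E 2 ^+ 16.
Proof.
have ea := theta3_euler F7_double_eq0; have G := quartic_product F7_double_eq0.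
apply: (mulI_coef0 (pcoef_eulers0 2 4 4 8)); rewrite /Y.
transitivity ((a * E 1 ^+ 2 * E 4 ^+ 2) ^+ 4
  * ((a ^+ 4 - b ^+ 4) * E 2 ^+ 4) *+ 4); first by ring.
rewrite ea G; apply: (@eq_mod7 (9 * q * E 2 ^+ 20 * E 4 ^+ 8)); ring.
Qed.

Lemma formX_euler : X * E 2 ^+ 8 = E 1 ^+ 16.
Proof.
by rewrite [E 1]dil1 formX_theta4 -exprMn gauss_theta4 -exprM.
Qed.

(** * Eta quotients and iterated derivatives *)

Lemma qX_mulI m (f g : K) : q ^+ m * f = q ^+ m * g -> f = g.
Proof. by elim: m => [|m IH]; rewrite ?mul1r // !exprS -!mulrA => /q_mulI. Qed.

Lemma qderiv_X :
  qderiv X = X * (Y * (u + Y *+ 2) *+ 5).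
Proof.
have [tA tY] := qderiv_AY; rewrite qderivB (qderivX _ 2) tA tY /= expr1.
by apply: (@eq_mod7 (Y ^+ 3 - 2 * u * Y ^+ 2)); ring.
Qed.

Definition eulerF : K := E 1 ^+ 4 * E 2 ^+ 8.
Definition eulerJ : K := E 1 ^+ 3.

Lemma XY_eulerF : X ^+ 4 * Y ^+ 5 = q ^+ 5 * eulerF ^+ 6.
Proof.
apply: (mulI_coef0 (pcoef_eulers0 2 1 32 40)).
transitivity ((X * E 2 ^+ 8) ^+ 4 * (Y * E 1 ^+ 8) ^+ 5); first by ring.
by rewrite formX_euler formY_euler /eulerF; ring.
Qed.

Lemma XY_eulerJ : X ^+ 2 * Y = q * eulerJ ^+ 8.
Proof.
apply: (mulI_coef0 (pcoef_eulers0 2 1 16 8)).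
transitivity ((X * E 2 ^+ 8) ^+ 2 * (Y * E 1 ^+ 8)); first by ring.
by rewrite formX_euler formY_euler /eulerJ; ring.
Qed.

(** The constant 2 is 5/6 in F_7: the operator is D acting on q^(5/6) F, the
    expansion of eta(tau)^4 eta(2 tau)^8, and the formula is the logarithmic
    derivative of XY_eulerF. *)
Lemma qderiv_eulerF :
  qderiv eulerF + eulerF *+ 2 = eulerF * (u ^+ 2 *+ 2 + Y ^+ 2).
Proof.
have F0 : (eulerF ^+ 5) 0%N = 1.
  exact/pcoefX_eq1/pcoef_eulers0.
have e : qderiv eulerF *+ 6 + eulerF *+ 5 = eulerF *
    (Y * (u + Y *+ 2) *+ 20 + (u ^+ 2 + u * Y *+ 3 + Y ^+ 2 *+ 3) *+ 5).
  apply: (mulI_coef0 F0); apply: (@qX_mulI 5).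
  transitivity (qderiv (q ^+ 5 * eulerF ^+ 6)).
    by rewrite !(qderivM, qderivX) qderiv_q /=; ring.
  rewrite -XY_eulerF qderivM !(qderivX _ 4, qderivX _ 5) qderiv_X.
  have [_ ->] := qderiv_AY.
  transitivity ((q ^+ 5 * eulerF ^+ 6) *
    (Y * (u + Y *+ 2) *+ 20 + (u ^+ 2 + u * Y *+ 3 + Y ^+ 2 *+ 3) *+ 5)).
    by rewrite -XY_eulerF /=; ring.
  by ring.
transitivity ((qderiv eulerF *+ 6 + eulerF *+ 5) *+ 6
  + 7 * (- qderiv eulerF *+ 5 - eulerF *+ 4)); first by ring.
rewrite e; apply: (@eq_mod7 (eulerF * (u ^+ 2 *+ 4 + u * Y *+ 30 + Y ^+ 2 *+ 47)
  - qderiv eulerF *+ 5 - eulerF *+ 4)).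
by ring.
Qed.

(** The shift by 1 is 1/8 in F_7: the operator is D acting on q^(1/8) J, the
    expansion of eta(tau)^3. *)
Lemma qderiv_eulerJ :
  qderiv eulerJ + eulerJ = eulerJ * (u ^+ 2 + u * Y *+ 6 + Y ^+ 2 *+ 2).
Proof.
have J0 : (eulerJ ^+ 7) 0%N = 1 by apply/pcoefX_eq1/pcoefX_eq1/pcoef_euler0.
have e : qderiv eulerJ *+ 8 + eulerJ = eulerJ *
    (Y * (u + Y *+ 2) *+ 10 + (u ^+ 2 + u * Y *+ 3 + Y ^+ 2 *+ 3)).
  apply: (mulI_coef0 J0); apply: (@qX_mulI 1); rewrite expr1.
  transitivity (qderiv (q * eulerJ ^+ 8)).
    by rewrite qderivM qderivX qderiv_q /=; ring.
  rewrite -XY_eulerJ qderivM (qderivX _ 2) qderiv_X.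
  have [_ ->] := qderiv_AY.
  transitivity ((q * eulerJ ^+ 8) *
    (Y * (u + Y *+ 2) *+ 10 + (u ^+ 2 + u * Y *+ 3 + Y ^+ 2 *+ 3))).
    by rewrite -XY_eulerJ /=; ring.
  by ring.
transitivity (qderiv eulerJ *+ 8 + eulerJ + 7 * (- qderiv eulerJ)).
  by ring.
rewrite e; apply: (@eq_mod7 (eulerJ * (u * Y + Y ^+ 2 *+ 3) - qderiv eulerJ)).
by ring.
Qed.

Definition qderiv_shift c (f : K) : K := qderiv f + f *+ c.

Lemma pcoef_iter_qderiv_shift c k f n :
  iter k (qderiv_shift c) f n = f n *+ ((n + c) ^ k).
Proof.
elim: k => [|k IH] //; rewrite iterS {1}/qderiv_shift.
by rewrite pcoefD pcoefMn pcoef_qderiv IH -mulrnDr -mulrnA expnSr.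
Qed.

Lemma qderiv_shiftM c f p s : qderiv_shift c f = f * s ->
  qderiv_shift c (f * p) = f * (qderiv p + s * p).
Proof.
move=> e; transitivity (qderiv_shift c f * p + f * qderiv p).
  by rewrite /qderiv_shift qderivM; ring.
by rewrite e; ring.
Qed.

Lemma qderiv_u : qderiv u = u * Y * X *+ 6.
Proof. by have [tA _] := qderiv_AY; rewrite qderivX tA /=; ring. Qed.

Definition qderiv_polyE :=
  (@qderivMn 'F_7, @qderivX 'F_7, @qderivD 'F_7, @qderivM 'F_7).

(** Applying D + 2 six times multiplies f by polynomials p1, p2, ..., p6 in v
    and y, where p_(i+1) = D p_i + p1 p_i is homogeneous of degree 2(i+1).  The
    last one has the stated form, v (v - 2y)^2 being the square of the
    Hasse invariant. *)
Lemma iter6_qderiv_shift (v y f : K) :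
  qderiv v = v * y * (v - y) *+ 6 ->
  qderiv y = y * (v ^+ 2 + v * y *+ 3 + y ^+ 2 *+ 3) ->
  qderiv_shift 2 f = f * (v ^+ 2 *+ 2 + y ^+ 2) ->
  iter 6 (qderiv_shift 2) f = f * ((v * (v - y *+ 2) ^+ 2) ^+ 4
    + v * (v - y *+ 2) ^+ 2 * ((v - y) ^+ 4 * y ^+ 5)).
Proof.
move=> tv ty d1; pose p1 := v ^+ 2 *+ 2 + y ^+ 2.
have step p r : qderiv p + p1 * p = r -> qderiv_shift 2 (f * p) = f * r.
  by move=> <-; apply: qderiv_shiftM d1.
pose p2 := v ^+ 4 *+ 4 + v ^+ 3 * y *+ 3 + v ^+ 2 * y ^+ 2 *+ 3
  + v * y ^+ 3 *+ 6.
pose p3 := v ^+ 6 + v ^+ 4 * y ^+ 2 *+ 4 + v ^+ 2 * y ^+ 4 *+ 5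
  + v * y ^+ 5 *+ 3.
pose p4 := v ^+ 8 *+ 2 + v ^+ 7 * y + v ^+ 6 * y ^+ 2 *+ 2 + v ^+ 5 * y ^+ 3
  + v ^+ 4 * y ^+ 4 *+ 4 + v ^+ 3 * y ^+ 5 + v ^+ 2 * y ^+ 6 *+ 5
  + v * y ^+ 7 *+ 2.
pose p5 := v ^+ 10 *+ 4 + v ^+ 9 * y + v ^+ 8 * y ^+ 2 + v ^+ 7 * y ^+ 3 *+ 2
  + v ^+ 6 * y ^+ 4 *+ 5 + v ^+ 5 * y ^+ 5 *+ 5 + v ^+ 4 * y ^+ 6
  + v ^+ 3 * y ^+ 7 *+ 5 + v ^+ 2 * y ^+ 8 *+ 5 + v * y ^+ 9 *+ 4.
have d2 : qderiv_shift 2 (f * p1) = f * p2.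
  apply: step; rewrite /p1 /p2 !qderiv_polyE !ty !tv /=.
  by apply: (@eq_mod7 (v ^+ 3 * y *+ 3 - v ^+ 2 * y ^+ 2 *+ 3
    + y ^+ 4)); ring.
have d3 : qderiv_shift 2 (f * p2) = f * p3.
  apply: step; rewrite /p1 /p2 /p3 !qderiv_polyE !ty !tv /=.
  by apply: (@eq_mod7 (v ^+ 6 + v ^+ 5 * y *+ 15 - v ^+ 4 * y ^+ 2 *+ 3
    + v ^+ 3 * y ^+ 3 *+ 6 + v ^+ 2 * y ^+ 4 *+ 10 + v * y ^+ 5 *+ 3)); ring.
have d4 : qderiv_shift 2 (f * p3) = f * p4.
  apply: step; rewrite /p1 /p3 /p4 !qderiv_polyE !ty !tv /=.
  by apply: (@eq_mod7 (v ^+ 7 * y *+ 5 - v ^+ 6 * y ^+ 2 *+ 3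
    + v ^+ 5 * y ^+ 3 *+ 17 - v ^+ 4 * y ^+ 4 *+ 6 + v ^+ 3 * y ^+ 5 *+ 20
    + v ^+ 2 * y ^+ 6 *+ 9 + v * y ^+ 7 *+ 4)); ring.
have d5 : qderiv_shift 2 (f * p4) = f * p5.
  apply: step; rewrite /p1 /p4 /p5 !qderiv_polyE !ty !tv /=.
  by apply: (@eq_mod7 (v ^+ 9 * y *+ 14 - v ^+ 8 * y ^+ 2 *+ 6
    + v ^+ 7 * y ^+ 3 *+ 7 + v ^+ 5 * y ^+ 5 *+ 18 + v ^+ 4 * y ^+ 6 *+ 4
    + v ^+ 3 * y ^+ 7 *+ 23 + v ^+ 2 * y ^+ 8 *+ 12 + v * y ^+ 9 *+ 4)); ring.
rewrite !iterS /= d1 -/p1 d2 d3 d4 d5.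
apply: step; rewrite /p1 /p5 !qderiv_polyE !ty !tv /=.
by apply: (@eq_mod7 (v ^+ 12 + v ^+ 11 * y *+ 37 - v ^+ 10 * y ^+ 2 *+ 41
  + v ^+ 9 * y ^+ 3 *+ 66 - v ^+ 8 * y ^+ 4 *+ 147 + v ^+ 7 * y ^+ 5 *+ 286
  - v ^+ 6 * y ^+ 6 *+ 238 + v ^+ 5 * y ^+ 7 *+ 145 + v ^+ 4 * y ^+ 8 *+ 4
  + v ^+ 3 * y ^+ 9 *+ 29 + v ^+ 2 * y ^+ 10 *+ 31
  + v * y ^+ 11 *+ 12)); ring.
Qed.

(** The same computation for D + 1, where p3 is a power of the Hasse
    invariant. *)
Lemma iter3_qderiv_shift (v y f : K) :
  qderiv v = v * y * (v - y) *+ 6 ->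
  qderiv y = y * (v ^+ 2 + v * y *+ 3 + y ^+ 2 *+ 3) ->
  qderiv_shift 1 f = f * (v ^+ 2 + v * y *+ 6 + y ^+ 2 *+ 2) ->
  iter 3 (qderiv_shift 1) f = f * ((v * (v - y *+ 2) ^+ 2) ^+ 2).
Proof.
move=> tv ty d1; pose p1 := v ^+ 2 + v * y *+ 6 + y ^+ 2 *+ 2.
have step p r : qderiv p + p1 * p = r -> qderiv_shift 1 (f * p) = f * r.
  by move=> <-; apply: qderiv_shiftM d1.
pose p2 := v ^+ 4 + v ^+ 3 * y *+ 2 + v ^+ 2 * y ^+ 2 *+ 2 + v * y ^+ 3 *+ 4
  + y ^+ 4 *+ 2.
have d2 : qderiv_shift 1 (f * p1) = f * p2.
  apply: step; rewrite /p1 /p2 !qderiv_polyE !ty !tv /=.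
  by apply: (@eq_mod7 (v ^+ 3 * y *+ 4 + v ^+ 2 * y ^+ 2 *+ 12
    + v * y ^+ 3 *+ 2 + y ^+ 4 *+ 2)); ring.
rewrite !iterS /= d1 -/p1 d2.
apply: step; rewrite /p1 /p2 !qderiv_polyE !ty !tv /=.
by apply: (@eq_mod7 (v ^+ 5 * y *+ 6 + v ^+ 4 * y ^+ 2 *+ 2
  + v ^+ 3 * y ^+ 3 *+ 10 + v ^+ 2 * y ^+ 4 *+ 10 + v * y ^+ 5 *+ 8
  + y ^+ 6 *+ 4)); ring.
Qed.

Lemma hasse_sqr : u * (u - Y *+ 2) ^+ 2 = 1.
Proof. by rewrite -exprMn hasse_AY expr1n. Qed.

Lemma iter_eulerF :
  iter 6 (qderiv_shift 2) eulerF = eulerF + q ^+ 5 * dil 7 eulerF.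
Proof.
rewrite (iter6_qderiv_shift qderiv_u (proj2 qderiv_AY) qderiv_eulerF).
by rewrite hasse_sqr expr1n XY_eulerF -pser_Frobenius //; ring.
Qed.

Lemma iter_eulerJ : iter 3 (qderiv_shift 1) eulerJ = eulerJ.
Proof.
rewrite (iter3_qderiv_shift qderiv_u (proj2 qderiv_AY) qderiv_eulerJ) hasse_sqr.
by rewrite expr1n mulr1.
Qed.

Lemma F7_mulrn_mod (x : 'F_7) m : x *+ m = x *+ (m %% 7).
Proof.
by rewrite {1}(divn_eq m 7) mulrnDr mulrnA mulrn_pchar ?add0r ?pchar_Fp.
Qed.

(** At q^n the operator (D + 2)^6 multiplies by (n + 2)^6, which vanishes for
    n = 5 modulo 7. *)
Lemma sect_eulerF : sect 7 5 eulerF = - eulerF.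
Proof.
apply/pserP => n; have := congr1 (fun f : K => f (7 * n + 5)%N) iter_eulerF.
rewrite pcoef_iter_qderiv_shift pcoefD pcoef_qXM ifF ?addnK; last by lia.
rewrite pcoef_dil dvdn_mulr // mulKn // F7_mulrn_mod -modnXm.
have -> : ((7 * n + 5 + 2) %% 7 = 0)%N by lia.
by move/esym/eqP; rewrite mulr0n addr_eq0 => /eqP.
Qed.

(** The equation (D + 1)^3 J = J forces J_n = 0 unless (n + 1)^3 = 1 modulo 7,
    that is, unless n is 0, 1 or 3. *)
Lemma sect_eulerJ r : r \in [:: 2; 4; 5; 6]%N -> sect 7 r eulerJ = 0.
Proof.
move=> rE; apply/pserP => n; rewrite pcoef0; set m := (7 * n + r)%N.
change (eulerJ m = 0).
have := congr1 (fun f : K => f m) iter_eulerJ.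
rewrite pcoef_iter_qderiv_shift F7_mulrn_mod -modnXm.
have [->|->] : (((m + 1) %% 7) ^ 3 %% 7 = 0 \/ ((m + 1) %% 7) ^ 3 %% 7 = 6)%N.
- have -> : ((m + 1) %% 7 = (r + 1) %% 7)%N.
    by rewrite /m -addnA mulnC modnMDl.
  by move: rE; rewrite !inE => /or4P[] /eqP->; [right|right|right|left].
- by [].
move=> e; apply: F7_double_eq0; rewrite mulr2n -{1}e -mulrSr.
by apply: mulrn_pchar; rewrite pchar_Fp.
Qed.

(** * The congruence *)

Definition reduce7 (f : fps) : K := Pser (fun n => (f n)%:~R).

Lemma reduce7M f g : reduce7 (fps_mul f g) = reduce7 f * reduce7 g.
Proof.
apply: pserP => n; rewrite pcoefM /= /fps_mul rmorph_sum.
by apply: eq_bigr => i _; rewrite rmorphM.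
Qed.

Lemma reduce7_one : reduce7 fps_one = 1.
Proof. by apply: pserP => n; rewrite pcoef1 /= /fps_one; case: eqP. Qed.

Lemma reduce7_qpoch m : (0 < m)%N -> reduce7 (qpoch 'X^m 'X^m) = E m.
Proof. by move=> m0; apply: pserP => n; apply: qpoch_dil. Qed.

Lemma reduce7_Delta k :
  reduce7 (Delta k) * (E 1 ^+ 3 * E (2 * (2 * k + 1))) = E 2 * E (2 * k + 1).
Proof.
have e : reduce7 (fps_mul (Delta k) (Delta_den k)) = reduce7 (Delta_num k).
  by apply: pserP => n; rewrite /= Delta_gf.
move: e; rewrite reduce7M /Delta_den /Delta_num /fps_exp /= !reduce7M.
rewrite reduce7_one mulr1 !reduce7_qpoch ?addn1 //.
by rewrite -[qpoch 'X 'X]/(qpoch 'X^1 'X^1) reduce7_qpoch.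
Qed.

(** C is the reduced generating function; c1 collects seventh powers so that
    every factor except F and C is a series in q^7, c2 is its section at 7n+5,
    and c3 the section of that at 7n+r, where J has no term. *)
Lemma Delta_vanish k m r n :
  (2 * k + 1 = 49 * m)%N -> r \in [:: 2; 4; 5; 6]%N ->
  (7 %| Delta k (7 * (7 * n + r) + 5)%N)%Z.
Proof.
move=> km rE; have m0 : (0 < m)%N by lia.
pose C := reduce7 (Delta k).
have gf := reduce7_Delta k; rewrite km in gf.
have fr (f : K) : f ^+ 7 = dil 7 f by apply: pser_Frobenius.
have d49 : E (49 * m) = dil 7 (E (7 * m)) by rewrite dil_dil // mulnA.
have d98 : E (2 * (49 * m)) = dil 7 (dil 7 (E (2 * m))).
  by rewrite !dil_dil // !mulnA; congr dil; lia.
have d7 : E (7 * m) = dil 7 (E m) by rewrite dil_dil.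
rewrite d98 d49 d7 -/C in gf.
have c1 : C * dil 7 (E 1 * E 2 * dil 7 (E (2 * m))) =
    eulerF * dil 7 (dil 7 (E m)).
  rewrite dilM (dilM 7 (E 1)) -[dil 7 (E 1)]fr -[dil 7 (E 2)]fr.
  transitivity (C * (E 1 ^+ 3 * dil 7 (dil 7 (E (2 * m))))
    * (E 1 ^+ 4 * E 2 ^+ 7)); first by ring.
  by rewrite gf /eulerF; ring.
have c2 : sect 7 5 C * dil 7 (E (2 * m)) = eulerJ * dil 7 (- (E 2 * E m)).
  have e0 : (E 1 * E 2) 0%N = 1 by apply: pcoefM_eq1; apply: pcoef_euler0.
  apply: (mulI_coef0 e0); have := congr1 (sect 7 5) c1.
  rewrite !sect_dil // sect_eulerF /eulerF /eulerJ => c.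
  transitivity (sect 7 5 C * (E 1 * E 2 * dil 7 (E (2 * m)))); first by ring.
  by rewrite c rmorphN /= dilM -[dil 7 (E 2)]fr; ring.
have c3 : sect 7 r (sect 7 5 C) = 0.
  have r7 : (r < 7)%N by move: rE; rewrite !inE => /or4P[] /eqP->.
  have := congr1 (sect 7 r) c2; rewrite !sect_dil // sect_eulerJ // mul0r => c.
  by apply: (mulI_coef0 (pcoef_euler0 _ (2 * m))); rewrite mulr0 mulrC.
have /eqP := congr1 (fun f : K => f n) c3.
by rewrite /sect /= -(dvdz_pcharf (pchar_Fp (isT : prime 7))).
Qed.

Local Close Scope ring_scope.

Theorem theorem1p3 (k : nat) (hk : (0 < k)%N) (hk49 : k = 24 %[mod 49])
    (s : nat) (hs : s \in [:: 19; 33; 40; 47]) (n : nat) :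
  (Delta k (49 * n + s) = 0 %[mod 7])%Z.
Proof.
have [m km] : exists m, 2 * k + 1 = 49 * m.
  by exists (2 * (k %/ 49) + 1); rewrite (divn_eq k 49) hk49; lia.
have [r rE ->] : exists2 r, r \in [:: 2; 4; 5; 6] & s = 7 * r + 5.
  by exists (s %/ 7); move: hs; rewrite !inE => /or4P[] /eqP ->.
have -> : 49 * n + (7 * r + 5) = 7 * (7 * n + r) + 5 by lia.
by rewrite mod0z; apply/dvdz_mod0P; apply: Delta_vanish km rE.
Qed.
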